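(* Let $\mathcal S\subset\mathbb Z^d$ be a finite weighted step set which is irreducible in the orthant, meaning that for any two lattice points $P,Q\in\mathbb Z_{\ge0}^d$ there is a walk of some length $n\ge1$ from $P$ to $Q$ with all steps in $\mathcal S$ and all points in $\mathbb R_+^d$, let $(a_{i,j})_{1\le i,j\le d}$ be the coefficients of its covariance matrix $\Delta$, and let $H=\langle r_1,\dots,r_d\rangle$ be the associated reflection group (all defined in the context). Then the group $H$ is infinite as soon as the following two conditions are satisfied: - $\Delta$ is not, up to a permutation of the indices (applied simultaneously to rows and columns), a block-diagonal matrix with a block of size $2$; - there exist $i\neq j$ such that $a_{i,j}\notin\bigl\{0,\pm\frac12,\pm\frac{\sqrt2}{2},\pm\frac{\sqrt3}{2},\pm\frac{\sqrt5-1}{4},\pm\frac{\sqrt5+1}{4}\bigr\}$, or equivalently such that $a_{i,j}$ is not of the form $\cos\bigl(\frac{k\pi}{m}\bigr)$ with $k\in\mathbb Z$ and $m\in\{1,2,3,4,5,6\}$.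
   Context: Setting. $d\ge1$; each $s\in\mathcal S$ carries a weight $w(s)>0$, normalized by $\sum_{s\in\mathcal S}w(s)=1$. For $P,Q\in\mathbb Z_{\ge0}^d$, $e_C(P,Q;n)$ denotes the weighted number of walks of length $n$ from $P$ to $Q$ with steps in $\mathcal S$ and all points in the orthant $C=\mathbb R_+^d$. Irreducibility: for any two lattice points $P,Q\in\mathbb Z_{\ge 0}^d$ there is $n\ge1$ with $e_C(P,Q;n)\neq0$. Inventory: $\chi_{\mathcal S}(x_1,\dots,x_d)=\sum_{s\in\mathcal S}w(s)x_1^{s_1}\cdots x_d^{s_d}$. Under irreducibility (known fact) the system $\partial\chi_{\mathcal S}/\partial x_1=\dots=\partial\chi_{\mathcal S}/\partial x_d=0$ has a unique solution $\boldsymbol{x_0}$ in $(0,\infty)^d$. Covariance matrix: $\Delta=(a_{i,j})$ with $a_{i,j}=\dfrac{\partial_{x_i}\partial_{x_j}\chi_{\mathcal S}(\boldsymbol{x_0})}{\sqrt{\partial_{x_i}^2\chi_{\mathcal S}(\boldsymbol{x_0})\,\partial_{x_j}^2\chi_{\mathcal S}(\boldsymbol{x_0})}}$. It is symmetric positive definite with unit diagonal (so $|a_{i,j}|<1$ for $i\ne j$); $\Delta^{1/2}$ is its symmetric positive definite square root. Group $H$: with $(e_i)$ the canonical basis of $\mathbb R^d$ and $u_i=\Delta^{1/2}e_i$, let $H_i=\langle u_i\rangle^\perp$ (for the standard scalar product), $r_i$ the orthogonal reflection with respect to the hyperplane $H_i$, and $H=\langle r_1,\dots,r_d\rangle\subset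 O(d)$. ''Block-diagonal with a block of size $2$, up to permutation'' means: there are two distinct indices $p,q$ such that $a_{p,j}=a_{q,j}=0$ for all $j\notin\{p,q\}$ (in particular this always holds when $d=2$). *)

(* Defs.v *)
From HB Require Import structures.
From mathcomp Require Import all_boot all_order all_algebra finmap.
From mathcomp Require Import all_classical all_reals all_analysis.

Set Implicit Arguments.
Unset Strict Implicit.
Unset Printing Implicit Defensive.

Import Order.TTheory GRing.Theory Num.Theory.
Import numFieldNormedType.Exports.

Local Open Scope classical_set_scope.
Local Open Scope ring_scope.

Definition in_orthant (d : nat) (P : 'rV[int]_d) : bool :=
  [forall i, 0 <= P 0 i].

(* The walk visits P :: p; its length (number of steps) is [size p]. *)
Definition is_walk (d : nat) (S : {fset 'rV[int]_d})
    (P : 'rV[int]_d) (p : seq 'rV[int]_d) : bool :=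
  all (@in_orthant d) (P :: p) && path [rel u v | v - u \in S] P p.

Definition irreducible_in_orthant (d : nat) (S : {fset 'rV[int]_d}) : Prop :=
  forall P Q : 'rV[int]_d, in_orthant P -> in_orthant Q ->
    exists p : seq 'rV[int]_d,
      [/\ (1 <= size p)%N, is_walk S P p & last P p = Q].

Section Inventory.
Variables (R : realType) (d : nat).

Definition inventory (S : {fset 'rV[int]_d}) (w : 'rV[int]_d -> R)
    (x : 'rV[R]_d) : R :=
  \sum_(s <- S) w s * \prod_(i < d) x 0 i ^ s 0 i.

Definition partial (i : 'I_d) (f : 'rV[R]_d -> R) (x : 'rV[R]_d) : R :=
  'D_(delta_mx 0 i : 'rV[R]_d) f x.

Definition is_critical_point (f : 'rV[R]_d -> R) (x : 'rV[R]_d) : Prop :=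
  (forall i, 0 < x 0 i) /\ (forall i, partial i f x = 0).

Definition covariance_matrix (f : 'rV[R]_d -> R) (x : 'rV[R]_d) : 'M[R]_d :=
  \matrix_(i, j) (partial i (partial j f) x /
    Num.sqrt (partial i (partial i f) x * partial j (partial j f) x)).

End Inventory.

Section ReflectionGroup.
Variables (R : realType) (d : nat).
Implicit Types A B : 'M[R]_d.

Definition is_spd A : Prop :=
  A^T = A /\ forall v : 'cV[R]_d, v != 0 -> 0 < (v^T *m A *m v) 0 0.

Definition is_spd_sqrt B A : Prop := is_spd B /\ B *m B = A.

(* Matrix, acting on column vectors, of the orthogonal reflection
   v |-> v - 2 <u, v> / <u, u> u  with respect to the hyperplane <u>^\perp. *)
Definition reflection (u : 'cV[R]_d) : 'M[R]_d :=
  1%:M - (2 / (u^T *m u) 0 0) *: (u *m u^T).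

Definition is_matrix_subgroup (G : set 'M[R]_d) : Prop :=
  [/\ G `<=` [set A | A \in unitmx],
      G 1%:M,
      (forall A B, G A -> G B -> G (A *m B)) &
      (forall A, G A -> G (invmx A))].

Definition generated_group (X : set 'M[R]_d) : set 'M[R]_d :=
  smallest is_matrix_subgroup X.

(* [col i B] is B e_i; B is meant to be the square root of the covariance
   matrix. *)
Definition reflection_group B : set 'M[R]_d :=
  generated_group [set reflection (col i B) | i in [set: 'I_d]].

Definition has_block_of_size_2 A : Prop :=
  exists p q : 'I_d, p != q /\
    forall j, j != p -> j != q -> A p j = 0 /\ A q j = 0.

End ReflectionGroup.

Definition exceptional_values (R : realType) : seq R :=
  [:: 0; 1 / 2; - (1 / 2);
      Num.sqrt 2 / 2; - (Num.sqrt 2 / 2);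
      Num.sqrt 3 / 2; - (Num.sqrt 3 / 2);
      (Num.sqrt 5 - 1) / 4; - ((Num.sqrt 5 - 1) / 4);
      (Num.sqrt 5 + 1) / 4; - ((Num.sqrt 5 + 1) / 4)].

Definition is_small_cos (R : realType) (a : R) : Prop :=
  exists (k : int) (m : nat), (1 <= m <= 6)%N /\ a = cos (k%:~R * pi / m%:R).

(* Main.v *)
(* Write [u_i] for the columns of [sqrtDelta]; they are linearly independent
   unit vectors with [<u_i, u_j> = a_ij]. If [a_ij = cos t] is not exceptional
   then, by Dirichlet approximation, some power of [r_j r_i] is a rotation of the
   plane [<u_i, u_j>] by a nonzero angle of at most 60 degrees, with cosine
   [c] in [1/2, 1). As [{i, j}] is not a block, some [u_l] is not orthogonal to
   this plane; let [n] be the unit normal of the plane inside the span [V] of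
   [u_i, u_j, u_l]. For [g] in the group preserving [V], put [t(g) = <n, g n>].
   If [|t(g)| < 1] and [rho] is the above rotation, then
   [t(g^-1 rho g) = t^2 + c (1 - t^2)] lies strictly between [|t(g)|] and [1],
   so that starting from [g = r_l] the group has infinitely many elements. *)
Require Import Defs.
From HB Require Import structures.
From mathcomp Require Import all_boot all_order all_algebra finmap.
From mathcomp Require Import all_classical all_reals all_analysis.
From mathcomp Require Import ring lra.

Import Order.TTheory GRing.Theory Num.Theory.
Import numFieldNormedType.Exports.

Local Open Scope classical_set_scope.
Local Open Scope ring_scope.

Set Implicit Arguments.
Unset Strict Implicit.

(** * Multiples of an angle, exceptional cosines and Dirichlet approximation *)

Section Trigonometry.
Variable R : realType.
Implicit Types (x y a : R) (k : int).

Lemma norm_sin_add_int_pi x k : `|sin (x + k%:~R * pi)| = `|sin x|.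
Proof.
have Hn (y : R) (n : nat) : `|sin (y + n%:R * pi)| = `|sin y|.
  elim: n => [|n IH]; first by rewrite mul0r addr0.
  by rewrite -natr1 mulrDl mul1r addrA sinDpi normrN.
case: k => n; first exact: Hn.
by rewrite NegzE mulrNz -(Hn (x + _) n.+1) mulNr subrK.
Qed.

(** Subtracting a multiple of [pi] brings [y] into [[0, pi)], where the sine vanishes only at 0. *)
Lemma sin_eq0_int_pi y : sin y = 0 <-> exists k, y = k%:~R * pi.
Proof.
split=> [sy0|[k ->]]; last first.
  by apply/eqP; rewrite -normr_eq0 -[_ * pi]add0r norm_sin_add_int_pi sin0 normr0.
have pi0 := pi_gt0 R.
pose k := Num.floor (y / pi); exists k.
have /andP[k1 k2] := floor_itv (y / pi).
rewrite -/k in k1 k2; rewrite ler_pdivlMr // in k1.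
rewrite ltr_pdivrMr // intrD mulrDl mul1r in k2.
have sr : sin (y - k%:~R * pi) = 0.
  by apply/eqP; rewrite -normr_eq0 -(norm_sin_add_int_pi _ k) subrK sy0 normr0.
apply/eqP; rewrite -subr_eq0; apply/negPn/negP => r0.
have : 0 < sin (y - k%:~R * pi).
  by apply: sin_gt0_pi; rewrite lt0r r0 subr_ge0 k1 ltrBlDl.
by rewrite sr ltxx.
Qed.

(* Up to the factor [sin t], the sines of the multiples of [t] are the
   Chebyshev polynomials of the second kind evaluated at [cos t]. *)
Lemma sin_chebyshev (t : R) (c := cos t) :
  [/\ sin (2 * t) = sin t * (2 * c),
      sin (3 * t) = sin t * (4 * c ^+ 2 - 1),
      sin (4 * t) = sin t * (8 * c ^+ 3 - 4 * c),
      sin (5 * t) = sin t * (16 * c ^+ 4 - 12 * c ^+ 2 + 1) &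
      sin (6 * t) = sin t * (32 * c ^+ 5 - 32 * c ^+ 3 + 6 * c)].
Proof.
have cs : cos t ^+ 2 = 1 - sin t ^+ 2 by exact: cos2sin2.
have s2 : sin t ^+ 2 = 1 - cos t ^+ 2 by exact: sin2cos2.
have S n : sin (n.+1%:R * t) = sin (n%:R * t) * cos t + cos (n%:R * t) * sin t.
  by rewrite -natr1 mulrDl mul1r sinD.
have C n : cos (n.+1%:R * t) = cos (n%:R * t) * cos t - sin (n%:R * t) * sin t.
  by rewrite -natr1 mulrDl mul1r cosD.
have e2s : sin (2 * t) = sin t * (2 * c) by rewrite S mul1r /c; ring.
have e2c : cos (2 * t) = 2 * c ^+ 2 - 1 by rewrite C mul1r /c -!expr2 s2; ring.
have e3s : sin (3 * t) = sin t * (4 * c ^+ 2 - 1) by rewrite S e2s e2c /c; ring.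
have e3c : cos (3 * t) = 4 * c ^+ 3 - 3 * c.
  rewrite C e2s e2c; transitivity (c * (2 * c ^+ 2 - 1) - 2 * c * sin t ^+ 2).
    by rewrite /c; ring.
  by rewrite s2 /c; ring.
have e4s : sin (4 * t) = sin t * (8 * c ^+ 3 - 4 * c) by rewrite S e3s e3c /c; ring.
have e4c : cos (4 * t) = 8 * c ^+ 4 - 8 * c ^+ 2 + 1.
  rewrite C e3s e3c.
  transitivity (c * (4 * c ^+ 3 - 3 * c) - (4 * c ^+ 2 - 1) * sin t ^+ 2).
    by rewrite /c; ring.
  by rewrite s2 /c; ring.
have e5s : sin (5 * t) = sin t * (16 * c ^+ 4 - 12 * c ^+ 2 + 1).
  by rewrite S e4s e4c /c; ring.
have e5c : cos (5 * t) = 16 * c ^+ 5 - 20 * c ^+ 3 + 5 * c.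
  rewrite C e4s e4c.
  transitivity (c * (8 * c ^+ 4 - 8 * c ^+ 2 + 1) - (8 * c ^+ 3 - 4 * c) * sin t ^+ 2).
    by rewrite /c; ring.
  by rewrite s2 /c; ring.
by split=> //; rewrite S e5s e5c /c; ring.
Qed.

(* The left-hand side collects the factors of the Chebyshev polynomials in
   [sin_chebyshev]. *)
Lemma exceptional_valuesP a :
  reflect (a * (4 * a ^+ 2 - 1) * (2 * a ^+ 2 - 1) * (4 * a ^+ 2 - 3) *
           (16 * a ^+ 4 - 12 * a ^+ 2 + 1) = 0)
          (a \in exceptional_values R).
Proof.
have s2 : Num.sqrt 2 ^+ 2 = 2 :> R by rewrite sqr_sqrtr.
have s3 : Num.sqrt 3 ^+ 2 = 3 :> R by rewrite sqr_sqrtr.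
have s5 : Num.sqrt 5 ^+ 2 = 5 :> R by rewrite sqr_sqrtr.
rewrite /exceptional_values.
move: (Num.sqrt 2) (Num.sqrt 3) (Num.sqrt 5) s2 s3 s5 => s t u s2 s3 u5.
set l := [:: _ & _].
(* The factor 512 is the leading coefficient of the left-hand side. *)
have E : a * (4 * a ^+ 2 - 1) * (2 * a ^+ 2 - 1) * (4 * a ^+ 2 - 3) *
         (16 * a ^+ 4 - 12 * a ^+ 2 + 1) = 512 * \prod_(b <- l) (a - b).
  have -> : 4 * a ^+ 2 - 1 = 4 * (a - 1 / 2) * (a - - (1 / 2)) by field.
  have -> : 2 * a ^+ 2 - 1 = 2 * (a - s / 2) * (a - - (s / 2)).
    by transitivity (2 * a ^+ 2 - s ^+ 2 / 2); [rewrite s2|]; field.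
  have -> : 4 * a ^+ 2 - 3 = 4 * (a - t / 2) * (a - - (t / 2)).
    by transitivity (4 * a ^+ 2 - t ^+ 2); [rewrite s3|field].
  have -> : 16 * a ^+ 4 - 12 * a ^+ 2 + 1 =
      16 * ((a - (u - 1) / 4) * (a - - ((u - 1) / 4)) *
            (a - (u + 1) / 4) * (a - - ((u + 1) / 4))).
    (* Expressing 12 and 1 through [u ^+ 2 = 5] turns the factorization into a polynomial identity
       in [u]. *)
    transitivity (16 * a ^+ 4 - (2 * u ^+ 2 + 2) * a ^+ 2 + (u ^+ 2 - 1) ^+ 2 / 16).
      by rewrite u5; field.
    by field.
  by rewrite /l !big_cons big_nil; field.
rewrite E; apply: (iffP idP) => [al|/eqP].
  apply/eqP; rewrite mulf_eq0 prodf_seq_eq0; apply/orP; right.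
  by apply/hasP; exists a; rewrite ?subrr /=.
rewrite mulf_eq0 pnatr_eq0 /= prodf_seq_eq0 => /hasP[b bl /=].
by rewrite subr_eq0 => /eqP ->.
Qed.

(** For [a = cos t] with [sin t] nonzero, [sin (m t) = 0] means that [t] is a multiple of [pi / m],
    and it amounts to the vanishing at [a] of a Chebyshev factor. For [m] from 2 to 6 this factor
    is, up to a constant, a product of factors from [exceptional_valuesP]; for [m = 1] it is 1. *)
Lemma is_small_cosP a : `|a| < 1 ->
  is_small_cos a <-> a \in exceptional_values R.
Proof.
move=> a1.
have ai : -1 <= a <= 1 by rewrite -ler_norml ltW.
split.
  move=> [k [m [mi ea]]].
  set t := k%:~R * pi / m%:R in ea.
  have st0 : sin t != 0.
    by apply/eqP => /sin0cos1; rewrite -ea => e; rewrite e ltxx in a1.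
  have m0 : m%:R != 0 :> R by rewrite pnatr_eq0 -lt0n; case/andP: mi.
  have smt : sin (m%:R * t) = 0.
    by apply/sin_eq0_int_pi; exists k; rewrite /t mulrCA mulfV // mulr1.
  apply/exceptional_valuesP.
  have [s2 s3 s4 s5 s6] := sin_chebyshev t; rewrite -ea in s2 s3 s4 s5 s6.
  have P (q : R) : sin (m%:R * t) = sin t * q -> q = 0.
    by rewrite smt => /esym/eqP; rewrite mulf_eq0 (negbTE st0) => /eqP.
  have : m \in [:: 1; 2; 3; 4; 5; 6]%N by move: mi; case: (m) => [|[|[|[|[|[|[|?]]]]]]].
  rewrite !inE => /or4P[/eqP m1|/eqP m2|/eqP m3|/or3P[]/eqP m456]; subst m.
  - by have /eqP := P 1 (etrans (congr1 _ (mul1r _)) (esym (mulr1 _))); rewrite oner_eq0.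
  - by have := P _ s2; nra.
  - by rewrite (P _ s3) !(mul0r, mulr0).
  - have e := P _ s4.
    have -> : a * (4 * a ^+ 2 - 1) * (2 * a ^+ 2 - 1) =
      (8 * a ^+ 3 - 4 * a) * (4 * a ^+ 2 - 1) / 4 by field.
    by rewrite e !mul0r.
  - by rewrite (P _ s5) mulr0.
  - have e := P _ s6.
    have -> : a * (4 * a ^+ 2 - 1) * (2 * a ^+ 2 - 1) * (4 * a ^+ 2 - 3) =
      (32 * a ^+ 5 - 32 * a ^+ 3 + 6 * a) * (2 * a ^+ 2 - 1) / 2 by field.
    by rewrite e !mul0r.
move=> /exceptional_valuesP h.
have ea : cos (acos a) = a by rewrite acosK // in_itv.
have P (m : nat) : (1 <= m <= 6)%N -> sin (m%:R * acos a) = 0 -> is_small_cos a.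
  move=> mi /sin_eq0_int_pi[k e]; exists k, m; split=> //.
  rewrite -e mulrC mulKf // pnatr_eq0 -lt0n; by case/andP: mi.
have [s2 s3 s4 s5 s6] := sin_chebyshev (acos a); rewrite ea in s2 s3 s4 s5 s6.
move/eqP: h; rewrite !mulf_eq0 -!orbA => /or4P[/eqP h|/eqP h|/eqP h|/orP[]/eqP h].
- by apply: (P 2%N) => //; rewrite s2 h !mulr0.
- by apply: (P 3%N) => //; rewrite s3 h mulr0.
- apply: (P 4%N) => //; rewrite s4.
  have -> : 8 * a ^+ 3 - 4 * a = 4 * a * (2 * a ^+ 2 - 1) by ring.
  by rewrite h !mulr0.
- apply: (P 6%N) => //; rewrite s6.
  have -> : 32 * a ^+ 5 - 32 * a ^+ 3 + 6 * a =
    2 * a * (4 * a ^+ 2 - 1) * (4 * a ^+ 2 - 3) by ring.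
  by rewrite h !mulr0.
- by apply: (P 5%N) => //; rewrite s5 h mulr0.
Qed.

(** Dirichlet's theorem for denominators up to [N = 5], with the bound [1 / (N + 1)]; it is checked
    on the fractional part of [x]. *)
Lemma dirichlet_approx5 x : exists (n : nat) k,
  (1 <= n <= 5)%N /\ `|n%:R * x - k%:~R| <= 1 / 6.
Proof.
pose f := Num.floor x; pose y := x - f%:~R.
have /andP[] := floor_itv x; rewrite intrD -/f => f1 f2.
have y0 : 0 <= y by rewrite subr_ge0.
have y1 : y <= 1 by rewrite /y lerBlDl ltW.
suff [n [k [ni h]]] : exists (n : nat) k, (1 <= n <= 5)%N /\ `|n%:R * y - k%:~R| <= 1 / 6.
  exists n, (n%:Z * f + k); split=> //; move: h.
  by rewrite /y rmorphD rmorphM /= mulrBr opprD addrA.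
have P (n k : nat) : (1 <= n <= 5)%N -> - (1 / 6) <= n%:R * y - k%:R <= 1 / 6 ->
   exists (n : nat) k, (1 <= n <= 5)%N /\ `|n%:R * y - k%:~R| <= 1 / 6.
  by move=> ni h; exists n, k; rewrite ler_norml.
(* The intervals [|y - k/n| <= 1/(6n)] with [n <= 5] cover [[0, 1]]; each
   bound below is the right endpoint of one of them. *)
have [h1|h1] := lerP y (1/6); first by apply: (P 1 0)%N => //; lra.
have [h2|h2] := lerP y (7/30); first by apply: (P 5 1)%N => //; lra.
have [h3|h3] := lerP y (7/24); first by apply: (P 4 1)%N => //; lra.
have [h4|h4] := lerP y (7/18); first by apply: (P 3 1)%N => //; lra.
have [h5|h5] := lerP y (13/30); first by apply: (P 5 2)%N => //; lra.
have [h6|h6] := lerP y (7/12); first by apply: (P 2 1)%N => //; lra.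
have [h7|h7] := lerP y (19/30); first by apply: (P 5 3)%N => //; lra.
have [h8|h8] := lerP y (13/18); first by apply: (P 3 2)%N => //; lra.
have [h9|h9] := lerP y (19/24); first by apply: (P 4 3)%N => //; lra.
have [h10|h10] := lerP y (25/30); first by apply: (P 5 4)%N => //; lra.
by apply: (P 1 1)%N => //; lra.
Qed.

(** The triple-angle formula gives [4 c^2 = 1] for [c = cos (pi / 3)], and [c] is positive. *)
Lemma cos_pi_third : cos (pi / 3) = 1 / 2 :> R.
Proof.
have pi0 := pi_gt0 R.
have s0 : sin (pi / 3) != 0 :> R.
  by rewrite gt_eqF // sin_gt0_pi //; apply/andP; split; lra.
have c0 : 0 < cos (pi / 3) :> R.
  by apply: cos_gt0_pihalf; apply/andP; split; lra.
have [_ s3 _ _ _] := sin_chebyshev (pi / 3).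
move: s3; rewrite mulrCA mulfV // mulr1 sinpi => /esym/eqP.
rewrite mulf_eq0 (negbTE s0) /= => /eqP h.
have : (cos (pi / 3) - 1 / 2) * (cos (pi / 3) + 1 / 2) = 0 :> R.
  by rewrite -[RHS](mul0r 4^-1) -h; field.
by move/eqP; rewrite mulf_eq0 => /orP[]/eqP; lra.
Qed.

(** Some [n t] lies within [pi / 6] of a multiple [k pi], so [2 n t] lies within [pi / 3] of a
    multiple of [2 pi]; equality [n t = k pi] would make [cos t] a small cosine. The angle is
    doubled because two reflections compose to a rotation by twice the angle between their
    normals. *)
Lemma cos_multiple_itv (t : R) : `|cos t| < 1 -> ~ is_small_cos (cos t) ->
  exists n : nat, 1 / 2 <= cos ((n%:R * t) *+ 2) < 1.
Proof.
move=> c1 nsc; have pi0 := pi_gt0 R.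
have [n [k [ni h]]] := dirichlet_approx5 (t / pi); exists n.
set y := n%:R * t - k%:~R * pi.
have hy : `|y| <= pi / 6.
  have -> : y = (n%:R * (t / pi) - k%:~R) * pi.
    by rewrite /y mulrBl -mulrA mulfVK // lt0r_neq0.
  by rewrite normrM (gtr0_norm pi0); nra.
have n0 : n%:R != 0 :> R by rewrite pnatr_eq0 -lt0n; case/andP: ni.
have y0 : y != 0.
  apply/eqP => ye; apply: nsc; exists k, n; split.
    by case/andP: ni => -> /= /leq_trans ->.
  by congr cos; move/eqP: ye; rewrite subr_eq0 => /eqP <-; field.
(* The cosine of a double angle depends only on the absolute value of the sine, which is insensitive
   to shifts by [pi] and to signs. *)
have -> : cos ((n%:R * t) *+ 2) = cos (`|y| *+ 2).
  have E z : cos (z *+ 2) = 1 - `|sin z| ^+ 2 *+ 2.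
    by rewrite cos_mulr2n real_normK ?num_real // cos2sin2; ring.
  rewrite !E; congr (1 - _ ^+ 2 *+ 2).
  rewrite -[n%:R * t](subrK (k%:~R * pi)) norm_sin_add_int_pi.
  by rewrite -/y; case: (ler0P y) => _; rewrite ?sinN ?normrN.
have yp : 0 < `|y| by rewrite normr_gt0.
have I (z : R) : 0 <= z <= pi / 3 -> z \in `[0, pi]%R.
  by move=> /andP[z0 z1]; rewrite in_itv /= z0; lra.
apply/andP; split.
  by rewrite -cos_pi_third leNgt ltr_cos ?I -?leNgt //; lra.
by rewrite -[X in _ < X]cos0 ltr_cos ?I //; lra.
Qed.

End Trigonometry.

(** If [s] listed [A], each step from [x] to [y] would lower the number of entries above the current
    value, since [y] counts for [t x] but no longer for [t y]. *)
Lemma infinite_set_increasing (R : realType) (T : eqType) (t : T -> R)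
    (A : set T) :
  A !=set0 -> (forall x, A x -> exists2 y, A y & t x < t y) -> infinite_set A.
Proof.
move=> [x0 Ax0] tA /finite_seqP[s As].
have [m] := ubnP (count (fun y => t x0 < t y) s).
elim: m x0 Ax0 => // m IH x Ax xm.
have [y Ay xy] := tA x Ax; apply: (IH y Ay); rewrite ltnS in xm; apply: leq_trans xm.
have ys : y \in s by move: Ay; rewrite As.
rewrite -[X in (_ < X)%N]size_filter -(count_predC (fun z => t y < t z)).
rewrite !count_filter -[X in (X < _)%N]addn0.
rewrite [X in (_ < X + _)%N](@eq_count _ _ (fun z => t y < t z)); last first.
  by move=> z /=; apply/andb_idr; apply: lt_trans.
rewrite ltn_add2l -has_count.
by apply/hasP; exists y => //=; rewrite ltxx.
Qed.

(** * Scalar product and reflections *)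

Section Dot.
Variables (R : realType) (d : nat).
Implicit Types (u v x y : 'cV[R]_d) (A : 'M[R]_d).

Definition dot u v : R := (u^T *m v) 0 0.

Lemma dotE u v : dot u v = \sum_i u i 0 * v i 0.
Proof. by rewrite /dot mxE; apply: eq_bigr => i _; rewrite mxE. Qed.

Lemma dotC u v : dot u v = dot v u.
Proof. by rewrite !dotE; apply: eq_bigr => i _; rewrite mulrC. Qed.

Lemma dotDr x u v : dot x (u + v) = dot x u + dot x v.
Proof. by rewrite /dot mulmxDr mxE. Qed.

Lemma dotZr a x u : dot x (a *: u) = a * dot x u.
Proof. by rewrite /dot -scalemxAr mxE. Qed.

Lemma dotNr x u : dot x (- u) = - dot x u.
Proof. by rewrite -scaleN1r dotZr mulN1r. Qed.

Lemma dotDl x u v : dot (u + v) x = dot u x + dot v x.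
Proof. by rewrite !(dotC _ x) dotDr. Qed.

Lemma dotZl a x u : dot (a *: u) x = a * dot u x.
Proof. by rewrite !(dotC _ x) dotZr. Qed.

Lemma dotNl x u : dot (- u) x = - dot u x.
Proof. by rewrite !(dotC _ x) dotNr. Qed.

Definition dot_linear := (dotDr, dotZr, dotNr, dotDl, dotZl, dotNl).

Lemma dot_mulmx A x y : dot x (A *m y) = dot (A^T *m x) y.
Proof. by rewrite /dot trmx_mul trmxK mulmxA. Qed.

Lemma dot_gt0 x : x != 0 -> 0 < dot x x.
Proof.
move=> x0; rewrite lt0r dotE sumr_ge0 => [|i _]; last by rewrite -expr2 sqr_ge0.
rewrite andbT psumr_neq0 => [|i _]; last by rewrite -expr2 sqr_ge0.
move: x0; apply: contraNT => /hasPn h; apply/eqP/colP => i.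
have := h i (mem_index_enum _); rewrite -expr2 lt0r sqr_ge0 sqrf_eq0 andbT negbK.
by rewrite mxE => /eqP.
Qed.

Lemma outer_mulE u v x : u *m v^T *m x = dot v x *: u.
Proof. by rewrite -mulmxA [v^T *m x]mx11_scalar mul_mx_scalar. Qed.

Lemma reflectionE u x :
  dot u u = 1 -> reflection u *m x = x - (2 * dot u x) *: u.
Proof.
move=> u1; rewrite /reflection -/(dot u u) u1 divr1 mulmxBl mul1mx.
by rewrite -scalemxAl outer_mulE scalerA.
Qed.

Lemma reflection_tr u : (reflection u)^T = reflection u.
Proof.
by rewrite /reflection linearB linearZ /= trmx1 trmx_mul trmxK.
Qed.

Lemma mulmx_cV_inj A B : (forall x : 'cV_d, A *m x = B *m x) -> A = B.
Proof.
by move=> h; apply/trmx_inj/row_matrixP => i; rewrite -!tr_col !colE h.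
Qed.

Lemma reflection_orthogonal u :
  dot u u = 1 -> (reflection u)^T *m reflection u = 1%:M.
Proof.
move=> u1; apply: mulmx_cV_inj => x.
rewrite reflection_tr mul1mx -mulmxA !reflectionE // !dot_linear u1.
by apply/colP => i; rewrite !mxE; ring.
Qed.

End Dot.

(** * Rotations and group elements preserving a three-dimensional subspace *)

Section Frame.
Variables (R : realType) (d : nat).
Variables f1 f2 n : 'cV[R]_d.
Hypotheses (f11 : dot f1 f1 = 1) (f22 : dot f2 f2 = 1) (nn : dot n n = 1).
Hypotheses (f12 : dot f1 f2 = 0) (f1n : dot f1 n = 0) (f2n : dot f2 n = 0).
Implicit Types (x y : 'cV[R]_d) (A B : 'M[R]_d).

Let f21 : dot f2 f1 = 0. Proof. by rewrite dotC. Qed.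
Let nf1 : dot n f1 = 0. Proof. by rewrite dotC. Qed.
Let nf2 : dot n f2 = 0. Proof. by rewrite dotC. Qed.
Let orthonormal := (f11, f22, nn, f12, f1n, f2n, f21, nf1, nf2).

(** The orthogonal projection onto the span V of the frame; [frame_proj *m x = x] expresses that [x]
    lies in V. *)
Definition frame_proj : 'M[R]_d := f1 *m f1^T + f2 *m f2^T + n *m n^T.

Lemma frame_projE x :
  frame_proj *m x = dot f1 x *: f1 + dot f2 x *: f2 + dot n x *: n.
Proof. by rewrite !mulmxDl !outer_mulE. Qed.

Lemma frame_proj_tr : frame_proj^T = frame_proj.
Proof. by rewrite /frame_proj !linearD /= !trmx_mul !trmxK. Qed.

Lemma frame_proj_normal : frame_proj *m n = n.
Proof. by rewrite frame_projE !orthonormal !scale0r scale1r !add0r. Qed.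

Lemma dot_frame x : frame_proj *m x = x ->
  dot x x = dot f1 x ^+ 2 + dot f2 x ^+ 2 + dot n x ^+ 2.
Proof.
move=> Vx; rewrite -{2}Vx frame_projE !dot_linear.
by rewrite (dotC x f1) (dotC x f2) (dotC x n) !expr2.
Qed.

(** Rotation by [a] from [f1] towards [f2], the identity on the orthogonal complement of their
    plane. *)
Definition rotation (a : R) : 'M[R]_d :=
  1%:M + (cos a - 1) *: (f1 *m f1^T + f2 *m f2^T) +
  sin a *: (f2 *m f1^T - f1 *m f2^T).

Lemma rotationE a x : rotation a *m x =
  x + ((cos a - 1) * dot f1 x - sin a * dot f2 x) *: f1 +
  (sin a * dot f1 x + (cos a - 1) * dot f2 x) *: f2.
Proof.
rewrite /rotation !(mulmxDl, mulmxBl, mulNmx, mul1mx) -!scalemxAl.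
rewrite !(mulmxDl, mulmxBl, mulNmx) !outer_mulE.
by apply/colP => i; rewrite !mxE; ring.
Qed.

Lemma rotation0 : rotation 0 = 1%:M.
Proof.
by rewrite /rotation cos0 sin0 subrr !scale0r !addr0.
Qed.

Lemma rotationD a b : rotation (a + b) = rotation a *m rotation b.
Proof.
apply: mulmx_cV_inj => x; rewrite -mulmxA !rotationE !dot_linear !orthonormal.
by apply/colP => i; rewrite !mxE cosD sinD; ring.
Qed.

(** The sine part is skew-symmetric and drops out of the quadratic form. *)
Lemma dot_rotation a x : dot x (rotation a *m x) =
  dot x x + (cos a - 1) * (dot f1 x ^+ 2 + dot f2 x ^+ 2).
Proof. by rewrite rotationE !dot_linear (dotC x f1) (dotC x f2); ring. Qed.

Lemma reflection_mul_rotation a :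
  reflection (cos a *: f1 + sin a *: f2) *m reflection f1 = rotation (a *+ 2).
Proof.
have cs : cos a * cos a + sin a * sin a = 1 by rewrite -!expr2 cos2Dsin2.
apply: mulmx_cV_inj => x; rewrite -mulmxA !reflectionE ?rotationE //; last first.
  by rewrite !dot_linear !orthonormal -[RHS]cs; ring.
rewrite !dot_linear !orthonormal; apply/colP => i; rewrite !mxE.
rewrite cos_mulr2n sin_mulr2n.
have s2 : sin a ^+ 2 = 1 - cos a ^+ 2 := sin2cos2 a.
ring: s2.
Qed.

Variable G : set 'M[R]_d.
Hypotheses (G1 : G 1%:M) (GM : forall A B, G A -> G B -> G (A *m B))
  (GV : forall A, G A -> G (invmx A)).

(** For an orthogonal matrix, commuting with the projection onto V is the same as preserving V. *)
Definition frame_stabilizer : set 'M[R]_d :=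
  [set A | [/\ G A, A^T *m A = 1%:M & frame_proj *m A = A *m frame_proj]].

Lemma frame_stabilizer1 : frame_stabilizer 1%:M.
Proof. by split=> //; rewrite ?trmx1 mulmx1 ?mul1mx. Qed.

Lemma frame_stabilizerM A B :
  frame_stabilizer A -> frame_stabilizer B -> frame_stabilizer (A *m B).
Proof.
move=> [GA oA cA] [GB oB cB]; split; first exact: GM.
  by rewrite trmx_mul mulmxA -(mulmxA _ A^T) oA mulmx1.
by rewrite mulmxA cA -mulmxA cB mulmxA.
Qed.

Lemma frame_stabilizer_tr A : frame_stabilizer A -> frame_stabilizer A^T.
Proof.
move=> [GA oA cA].
have uA : A \in unitmx by case: (mulmx1_unit oA).
have eA : A^T = invmx A by rewrite -[A^T](mulmxK uA) oA mul1mx.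
split; first by rewrite eA; apply: GV.
  by rewrite trmxK eA mulmxV.
by rewrite -{1}frame_proj_tr -trmx_mul -cA trmx_mul frame_proj_tr.
Qed.

Lemma frame_stabilizer_reflection u : dot u u = 1 ->
  frame_proj *m u = u -> G (reflection u) -> frame_stabilizer (reflection u).
Proof.
move=> u1 Vu Gu; split=> //; first exact: reflection_orthogonal.
(* A symmetric matrix fixing [u] commutes with [u *m u^T]. *)
rewrite /reflection mulmxBr mulmxBl mulmx1 mul1mx -scalemxAr -scalemxAl.
by rewrite mulmxA Vu -mulmxA -{3}frame_proj_tr -trmx_mul Vu.
Qed.

(* A rotation about [n] by an angle of at most 60 degrees, conjugated by a
   group element [A] moving the axis [n], gives an element that moves [n]
   less than [A] does, but still moves it. *)
Lemma frame_stabilizer_closer a A :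
    1 / 2 <= cos a < 1 -> frame_stabilizer (rotation a) ->
    frame_stabilizer A -> `|dot n (A *m n)| < 1 ->
  let B := A^T *m (rotation a *m A) in
  [/\ frame_stabilizer B, `|dot n (B *m n)| < 1 &
      dot n (A *m n) < dot n (B *m n)].
Proof.
move=> ca SR SA; set t := dot n _ => t1 B.
have SB : frame_stabilizer B.
  apply: frame_stabilizerM; first exact: frame_stabilizer_tr.
  exact: frame_stabilizerM.
case: SA => _ oA cA.
(* Moving [A^T] across leaves the quadratic form of the rotation at [A *m n], a unit vector of V
   with component [t] along [n], hence with squared length [1 - t ^+ 2] in the plane. *)
have tB : dot n (B *m n) = 1 + (cos a - 1) * (1 - t ^+ 2).
  have xx : dot (A *m n) (A *m n) = 1 by rewrite dot_mulmx mulmxA oA mul1mx.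
  have Vx : frame_proj *m (A *m n) = A *m n.
    by rewrite mulmxA cA -mulmxA frame_proj_normal.
  rewrite /B -!mulmxA dot_mulmx trmxK dot_rotation xx.
  by congr (_ + _ * _); move: (dot_frame Vx); rewrite xx -/t => ->; ring.
move: t1 ca; rewrite ltr_norml => /andP[t1 t2] /andP[c1 c2].
have t3 : 0 < 1 - t ^+ 2 by nra.
have t4 : 0 < (1 - cos a) * (1 - t ^+ 2) by apply: mulr_gt0; rewrite // subr_gt0.
(* As [cos a] is at least [1 / 2], the new value is at least [(1 + t^2) / 2], which exceeds [t] by
   [(1 - t)^2 / 2]. *)
have t5 : (1 - cos a) * (1 - t ^+ 2) <= 1 / 2 * (1 - t ^+ 2).
  by rewrite ler_pM2r //; lra.
have tB' : dot n (B *m n) = 1 - (1 - cos a) * (1 - t ^+ 2) by rewrite tB; ring.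
have t6 : 0 < (1 - t) ^+ 2 by rewrite exprn_gt0 ?subr_gt0.
split=> //; rewrite tB'; last by rewrite -subr_gt0; lra.
by rewrite ltr_norml; apply/andP; split; [have := sqr_ge0 t|]; lra.
Qed.

End Frame.

(** * Three reflections generating an infinite group; Gram and covariance matrices *)

Section Reflections.
Variables (R : realType) (d : nat).
Implicit Types (u v : 'cV[R]_d) (B Delta : 'M[R]_d) (G : set 'M[R]_d).

(** Gram-Schmidt turns [u1, u2, u3] into the frame [u1, f2, n]: [indep] makes the third vector
    nonzero, and [conn] keeps [u3] off the axis [n]. Iterating [frame_stabilizer_closer] from
    [reflection u3] then never ends. *)
Lemma infinite_group_of_three_reflections G u1 u2 u3 :
    G 1%:M -> (forall A B, G A -> G B -> G (A *m B)) ->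
    (forall A, G A -> G (invmx A)) ->
    dot u1 u1 = 1 -> dot u2 u2 = 1 -> dot u3 u3 = 1 ->
    G (reflection u1) -> G (reflection u2) -> G (reflection u3) ->
    `|dot u1 u2| < 1 -> ~ is_small_cos (dot u1 u2) ->
    (forall x y, u3 + x *: u1 + y *: u2 != 0) ->
    dot u1 u3 != 0 \/ dot u2 u3 != 0 ->
  infinite_set G.
Proof.
move=> G1 GM GV u11 u22 u33 Gu1 Gu2 Gu3 a1 nsc indep conn.
set a := dot u1 u2 in a1 nsc.
pose t := acos a.
have ai : -1 <= a <= 1 by rewrite -ler_norml ltW.
have ct : cos t = a by rewrite acosK // in_itv.
rewrite -ct in a1 nsc.
have st0 : sin t != 0 by apply/eqP => /sin0cos1 h; rewrite h ltxx in a1.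
have st2 : sin t ^+ 2 = 1 - a ^+ 2 by rewrite sin2cos2 ct.
have [m cm] := cos_multiple_itv a1 nsc.
pose f2 := (sin t)^-1 *: (u2 - a *: u1).
have u2E : u2 = cos t *: u1 + sin t *: f2.
  by rewrite /f2 scalerA mulfV // scale1r ct addrC subrK.
have u21 : dot u2 u1 = a by rewrite dotC.
have f12 : dot u1 f2 = 0 by rewrite !dot_linear u11 -/a; ring.
have f22 : dot f2 f2 = 1.
  rewrite !dot_linear u11 u22 u21 -/a.
  transitivity ((sin t)^-1 ^+ 2 * (1 - a ^+ 2)); first by ring.
  by rewrite -st2 -exprMn mulVf // expr1n.
have f2E : f2 = (sin t)^-1 *: (u2 - a *: u1) by [].
clearbody f2.
pose p := dot u1 u3; pose q := dot f2 u3.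
pose n0 := u3 - p *: u1 - q *: f2.
have n0D : n0 = u3 - p *: u1 - q *: f2 by [].
clearbody n0.
have n00 : n0 != 0.
  have -> : n0 = u3 + (q / sin t * a - p) *: u1 + (- (q / sin t)) *: u2.
    by apply/colP => i; rewrite n0D f2E !mxE; ring.
  exact: indep.
have f21 : dot f2 u1 = 0 by rewrite dotC.
have f1n0 : dot u1 n0 = 0 by rewrite n0D !dot_linear u11 f12 -/p; ring.
have f2n0 : dot f2 n0 = 0 by rewrite n0D !dot_linear f22 f21 -/q; ring.
have n0u3 : dot n0 u3 = dot n0 n0.
  by rewrite {3}n0D !dot_linear (dotC n0 u1) (dotC n0 f2) f1n0 f2n0; ring.
have n0E : dot n0 n0 = 1 - p ^+ 2 - q ^+ 2.
  by rewrite -n0u3 n0D !dot_linear u33 -/p -/q; ring.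
have n0p := dot_gt0 n00.
have n0lt1 : dot n0 n0 < 1.
  rewrite n0E -subr_gt0.
  (* If [p] and [q] both vanished, [u3] would be orthogonal to [u1] and [u2], against [conn]. *)
  suff : 0 < p ^+ 2 + q ^+ 2 by lra.
  rewrite lt0r addr_ge0 ?sqr_ge0 // andbT paddr_eq0 ?sqr_ge0 // !sqrf_eq0.
  apply/negP => /andP[/eqP p0 /eqP q0]; case: conn; rewrite -/p ?p0 ?eqxx //.
  by rewrite u2E !dot_linear -/p -/q p0 q0 !mulr0 addr0 eqxx.
pose r := Num.sqrt (dot n0 n0).
have r2 : r ^+ 2 = dot n0 n0 by rewrite sqr_sqrtr // ltW.
have r0 : r != 0 by rewrite gt_eqF // sqrtr_gt0.
pose n := r^-1 *: n0.
have nD : n = r^-1 *: n0 by [].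
clearbody n.
have nn : dot n n = 1.
  by rewrite nD !dot_linear -r2; field.
have f1n : dot u1 n = 0 by rewrite nD dotZr f1n0 mulr0.
have f2n : dot f2 n = 0 by rewrite nD dotZr f2n0 mulr0.
have nu3 : dot n u3 = r by rewrite nD dotZl n0u3 -r2; field.
have V1 : frame_proj u1 f2 n *m u1 = u1.
  by rewrite frame_projE u11 f21 (dotC n) f1n scale1r !scale0r !addr0.
have V2 : frame_proj u1 f2 n *m u2 = u2.
  rewrite u2E mulmxDr -!scalemxAr V1 frame_projE f22 f12 (dotC n) f2n.
  by rewrite scale1r !scale0r addr0 add0r.
have V3 : frame_proj u1 f2 n *m u3 = u3.
  rewrite frame_projE nu3 -/p -/q nD scalerA mulfV // scale1r n0D.
  by apply/colP => i; rewrite !mxE; ring.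
pose S := frame_stabilizer u1 f2 n G.
have S1 : S (reflection u1) by apply: frame_stabilizer_reflection.
have S2 : S (reflection u2) by apply: frame_stabilizer_reflection.
have S3 : S (reflection u3) by apply: frame_stabilizer_reflection.
have SM A B : S A -> S B -> S (A *m B) by apply: frame_stabilizerM.
(* These are the powers of [reflection u2 *m reflection u1]. *)
have Srot k : S (rotation u1 f2 ((k%:R * t) *+ 2)).
  elim: k => [|k IH].
    by rewrite mul0r mul0rn rotation0; exact: frame_stabilizer1.
  have -> : k.+1%:R * t *+ 2 = t *+ 2 + k%:R * t *+ 2 by rewrite -natr1; ring.
  rewrite rotationD // -reflection_mul_rotation // -u2E.
  by apply: (SM) IH; apply: SM.
pose X := [set A | S A /\ `|dot n (A *m n)| < 1].
suff : infinite_set X by apply: contra_not; apply: sub_finite_set => A [[]].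
apply: (@infinite_set_increasing _ _ (fun A => dot n (A *m n))).
  (* The starting value is [1 - 2 r^2], strictly between -1 and 1 because [0 < r^2 < 1]. *)
  exists (reflection u3); split=> //.
  rewrite reflectionE // !dot_linear nn nu3 (dotC u3) nu3.
  have -> : 1 - 2 * r * r = 1 - 2 * dot n0 n0 by rewrite -r2; ring.
  by rewrite ltr_norml; apply/andP; split; lra.
move=> A [SA tA].
have [SB tB lAB] := frame_stabilizer_closer nn f1n f2n GM GV cm (Srot m) SA tA.
by eexists; first by split; [exact: SB|].
Qed.

Lemma spd_mulmx_neq0 B v : is_spd B -> v != 0 -> B *m v != 0.
Proof.
move=> [_ pB] v0; apply/eqP => Bv0.
by have := pB v v0; rewrite -mulmxA Bv0 mulmx0 mxE ltxx.
Qed.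

(** The combination is the image under [B] of a vector whose coordinate [l] is 1. The indices [i]
    and [j] may coincide, so two columns are covered as well. *)
Lemma spd_col_indep B (i j l : 'I_d) (x y : R) : is_spd B ->
  l != i -> l != j -> col l B + x *: col i B + y *: col j B != 0.
Proof.
move=> spdB li lj.
pose v : 'cV[R]_d := delta_mx l 0 + x *: delta_mx i 0 + y *: delta_mx j 0.
have v0 : v != 0.
  apply/eqP => /colP/(_ l)/eqP.
  rewrite !mxE !eqxx (negbTE li) (negbTE lj) /= !mulr0 !addr0.
  by rewrite oner_eq0.
have -> : col l B + x *: col i B + y *: col j B = B *m v.
  by rewrite !mulmxDr -!scalemxAr -!colE.
exact: spd_mulmx_neq0.
Qed.

Lemma dot_col_sqrt B Delta (i j : 'I_d) : is_spd_sqrt B Delta ->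
  dot (col i B) (col j B) = Delta i j.
Proof.
move=> [[sB _] <-]; rewrite dotE mxE; apply: eq_bigr => k _.
by rewrite !mxE -{1}sB mxE.
Qed.

(** For a second derivative [c] the entry is [c / |c|], that is 1, -1, or 0 by the convention for
    division by zero; positivity leaves only 1. *)
Lemma covariance_matrix_diag (f : 'rV[R]_d -> R) (x : 'rV[R]_d) i :
  covariance_matrix f x i i > 0 -> covariance_matrix f x i i = 1.
Proof.
rewrite mxE -expr2 sqrtr_sqr.
have [c0|c0|->] := ltrgt0P (partial i (partial i f) x).
- by rewrite mulfV // gt_eqF.
- by rewrite invrN mulrN mulfV ?lt_eqF // ltr0N1.
- by rewrite mul0r ltxx.
Qed.

End Reflections.

(** * The generated group and the conclusion *)

Lemma generated_group_closed (R : realType) (d : nat) (X : set 'M[R]_d) :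
  let G := generated_group X in
  [/\ X `<=` G, G 1%:M, (forall A B, G A -> G B -> G (A *m B)) &
      (forall A, G A -> G (invmx A))].
Proof.
split; first exact: sub_gen_smallest.
- by move=> K [[]].
- move=> A B GA GB K KX; case: (KX) => [[_ _ KM _] _].
  exact: KM (GA _ KX) (GB _ KX).
- by move=> A GA K KX; case: (KX) => [[_ _ _ KV] _]; exact: KV (GA _ KX).
Qed.

Unset Implicit Arguments.
Set Strict Implicit.

Theorem proposition8 (R : realType) (d : nat) (hd : (1 <= d)%N)
    (S : {fset 'rV[int]_d}) (w : 'rV[int]_d -> R)
    (w_gt0 : forall s, s \in S -> 0 < w s)
    (w_sum1 : \sum_(s <- S) w s = 1)
    (S_irr : irreducible_in_orthant S)
    (x0 : 'rV[R]_d) (x0_crit : is_critical_point (inventory S w) x0)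
    (Delta : 'M[R]_d) (DeltaE : Delta = covariance_matrix (inventory S w) x0)
    (sqrtDelta : 'M[R]_d) (sqrtDeltaP : is_spd_sqrt sqrtDelta Delta) :
  (forall i j : 'I_d, i != j ->
     Delta i j \notin exceptional_values R <-> ~ is_small_cos (Delta i j)) /\
  (~ has_block_of_size_2 Delta ->
   (exists i j : 'I_d, i != j /\ Delta i j \notin exceptional_values R) ->
   infinite_set (reflection_group sqrtDelta)).
Proof.
have [spdB _] := sqrtDeltaP.
pose u i := col i sqrtDelta.
have uu i j : dot (u i) (u j) = Delta i j by exact: dot_col_sqrt.
(* Diagonal entries are squared norms of columns of the square root, so their sign is known without
   computing derivatives. *)
have D0 i : 0 < Delta i i.
  rewrite -uu; apply: dot_gt0; rewrite /u colE; apply: spd_mulmx_neq0 => //.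
  by apply/eqP => /matrixP/(_ i 0)/eqP; rewrite !mxE !eqxx oner_eq0.
have D1 i : Delta i i = 1.
  by move: (D0 i); rewrite DeltaE; exact: covariance_matrix_diag.
have DC i j : Delta i j = Delta j i by rewrite -!uu dotC.
(* Strict Cauchy-Schwarz: for unit vectors, [u j - a u i] with [a = Delta i j] has squared norm
   [1 - a^2]. *)
have Dlt1 i j : i != j -> `|Delta i j| < 1.
  rewrite eq_sym => ij.
  have := dot_gt0 (spd_col_indep (- Delta i j) 0 spdB ij ij).
  rewrite scale0r addr0 -/(u i) -/(u j) !dot_linear !uu !D1 (DC j i) => h.
  by rewrite ltr_norml; apply/andP; split; nra.
split=> [i j ij|noblock [i [j [ij aij]]]].
  rewrite (is_small_cosP (Dlt1 _ _ ij)).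
  by split; [move/negP | move=> h; apply/negP].
(* Without such an [l], the pair [i, j] would itself be a block of size 2. *)
have [l [li lj conn]] : exists l, [/\ l != i, l != j &
    Delta i l != 0 \/ Delta j l != 0].
  apply: contra_notP noblock => nol; exists i, j; split=> // l li lj.
  by split; apply/eqP/negPn/negP => D; apply: nol; exists l; split=> //; [left|right].
have [HX H1 HM HV] :=
  generated_group_closed [set reflection (u k) | k in [set: 'I_d]].
have Hr k : reflection_group sqrtDelta (reflection (u k)).
  by apply: HX; exists k.
apply: (infinite_group_of_three_reflections (u1 := u i) (u2 := u j) (u3 := u l))
  => //; rewrite ?uu //.
- exact: Dlt1.
- by rewrite (is_small_cosP (Dlt1 _ _ ij)); apply/negP.
- by move=> x y; exact: spd_col_indep.
Qed.
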